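(* Let $R=\mathbb Z$ or $\mathbb F_p$ ($p$ a prime), let $X$ be a set, let $M=M(X,R)$ be the set of all functions $X\to R$, and let $\mu\colon M\times M\to M$ be an arbitrary binary operation. Then the degree-preserving $R$-linear map $\psi=\psi_{X,\mu}\colon\mathsf T_R^{\le2}(X)\to C_\mu(X)$ is a monomorphism that commutes with cup products, cup-one products, and the $\circ$ map.
   Context: Free binomial algebra. $\mathrm{Int}(\mathbb{Z}^X)=\{q\in\mathbb{Q}[X] : q(\mathbb{Z}^X)\subseteq\mathbb{Z}\}$, and $\mathrm{Int}(\mathbb{F}_p^X)$ is the quotient of $\mathrm{Int}(\mathbb{Z}^X)$ by the ideal generated by $\binom{x}{n}$ ($x\in X$, $n\ge p$), tensored with $\mathbb{F}_p$. $\mathfrak{m}_{X,R}\subset \mathrm{Int}(R^X)$ is the submodule of polynomials with zero constant term; $\mathsf{T}_R(X)=T^*(\mathfrak{m}_{X,R})$ is the tensor algebra over $R$, with product $\cup=\otimes$, and maps $a\cup_1 b=ab$ on $\mathsf T^1=\mathfrak m_{X,R}$, $(a\otimes b)\cup_1 c=ac\otimes b+a\otimes bc$ from $\mathsf T^2\otimes\mathsf T^1$ to $\mathsf T^2$, and $(a_1\otimes a_2)\circ(b_1\otimes b_2)=a_1b_1\otimes a_2b_2$ on $\mathsf T^2$. $\mathsf T_R^{\le2}(X)=\mathsf T^0\oplus\mathsf T^1\oplus\mathsf T^2$. The complex $C_\mu(X)$. The magma $(M,\mu)$ determines a 2-dimensional $\Delta$-set $\Delta^{(2)}(M,\mu)$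 with one vertex, one 1-simplex for each $\mathbf a\in M$, and one 2-simplex for each pair $(\mathbf a,\mathbf a')\in M\times M$, with front face $\mathbf a$, back face $\mathbf a'$, and third face $\mu(\mathbf a,\mathbf a')$. $C_\mu(X)$ is its simplicial cochain complex with coefficients in $R$, with cup product $(f\cup g)(\mathbf a,\mathbf a')=f(\mathbf a)g(\mathbf a')$ of 1-cochains, $(f\cup_1g)(\mathbf a)=f(\mathbf a)g(\mathbf a)$ on 1-cochains, $(v\circ w)(s)=v(s)w(s)$ on 2-cochains, and $(f\cup g)\cup_1h=f\cup(g\cup_1h)+(f\cup_1h)\cup g$ for 1-cochains $f,g,h$. The map $\psi$. $\psi$ sends $1\in\mathsf T^0=R$ to the unit 0-cochain; $q\in\mathfrak m_{X,R}$ to the 1-cochain $\mathbf a\mapsto q(\mathbf a)$ (evaluation of the polynomial at the function $\mathbf a\colon X\to R$); and $q\otimes q'\in\mathsf T^2$ to the 2-cochain $(\mathbf a,\mathbf a')\mapsto q(\mathbf a)\,q'(\mathbf a')$. *)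

(* Defs.v *)
From HB Require Import structures.
From mathcomp Require Import all_boot all_order all_algebra.
From mathcomp Require Import finmap boolp functions ring.
From mathcomp.multinomials Require Import monalg.

Set Implicit Arguments.
Unset Strict Implicit.
Unset Printing Implicit Defensive.

Import Order.TTheory GRing.Theory Num.Theory.
Local Open Scope ring_scope.
Local Open Scope quotient_scope.

Section Tensor.
Variables (R : comNzRingType) (U V : lmodType R).

(* The submodule of the free module on U * V generated by the bilinearity
   relations. *)
Inductive bilin_rel : {malg R[(U * V)%type]} -> Prop :=
| bilin_rel_linl c u u' v :
    bilin_rel (<< (c *: u + u', v) >> - c *: << (u, v) >> - << (u', v) >>)
| bilin_rel_linr c u v v' :
    bilin_rel (<< (u, c *: v + v') >> - c *: << (u, v) >> - << (u, v') >>)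
| bilin_rel0 : bilin_rel 0
| bilin_rel_lin c s t : bilin_rel s -> bilin_rel t -> bilin_rel (c *: s + t).

Definition bilin_null : {pred {malg R[(U * V)%type]}} :=
  fun t => `[< bilin_rel t >].

Lemma bilin_null_submod : submod_closed bilin_null.
Proof.
split=> [|c s t /asboolP hs /asboolP ht]; apply/asboolP; first exact: bilin_rel0.
exact: bilin_rel_lin.
Qed.
HB.instance Definition _ :=
  GRing.isSubmodClosed.Build R _ bilin_null bilin_null_submod.

Definition tensor : Type := Quotient.quot bilin_null.
HB.instance Definition _ := GRing.Zmodule.on tensor.
HB.instance Definition _ := ZmodQuotient.on tensor.

Definition tensor_scale (c : R) (t : tensor) : tensor := \pi_tensor (c *: repr t).

Lemma pi_tensor_scale c x : \pi_tensor (c *: x) = tensor_scale c (\pi x).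
Proof.
apply/eqP; rewrite -Quotient.idealrBE -scalerBr rpredZ //.
by rewrite Quotient.idealrBE reprK.
Qed.

Lemma tensor_scaleA a b t :
  tensor_scale a (tensor_scale b t) = tensor_scale (a * b) t.
Proof. by rewrite [tensor_scale b t]/tensor_scale -pi_tensor_scale scalerA. Qed.
Lemma tensor_scale1 : left_id 1 tensor_scale.
Proof. by move=> t; rewrite /tensor_scale scale1r reprK. Qed.
Lemma tensor_scaleDr : right_distributive tensor_scale +%R.
Proof.
move=> a; elim/quotW=> s; elim/quotW=> t.
by rewrite -raddfD -!pi_tensor_scale scalerDr raddfD.
Qed.
Lemma tensor_scaleDl t : {morph tensor_scale^~ t : a b / a + b}.
Proof. by move=> a b; rewrite /tensor_scale scalerDl raddfD. Qed.
HB.instance Definition _ := GRing.Zmodule_isLmodule.Build R tensor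
  tensor_scaleA tensor_scale1 tensor_scaleDr tensor_scaleDl.

Lemma pi_tensorZ c x : \pi_tensor (c *: x) = c *: (\pi_tensor x : tensor).
Proof. exact: pi_tensor_scale. Qed.

End Tensor.

Arguments bilin_null {R} U V _.
Arguments tensor {R} U V.

HB.lock Definition tens (R : comNzRingType) (U V : lmodType R) (u : U) (v : V)
  : tensor U V := \pi_(tensor U V) << (u, v) >>.
Canonical tens_unlockable := Unlockable tens.unlock.

Section TensTheory.
Variables (R : comNzRingType) (U V : lmodType R).
Notation tensor := (tensor U V).
Notation tens := (@tens R U V).

Lemma tens_linl c u u' v : tens (c *: u + u') v = c *: tens u v + tens u' v.
Proof.
rewrite tens.unlock -pi_tensorZ -raddfD /=.
apply/eqP; rewrite -Quotient.idealrBE opprD addrA.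
by apply/asboolP; exact: bilin_rel_linl.
Qed.

Lemma tens_linr c u v v' : tens u (c *: v + v') = c *: tens u v + tens u v'.
Proof.
rewrite tens.unlock -pi_tensorZ -raddfD /=.
apply/eqP; rewrite -Quotient.idealrBE opprD addrA.
by apply/asboolP; exact: bilin_rel_linr.
Qed.

Lemma tens0l v : tens 0 v = 0.
Proof.
by have := tens_linl (-1) 0 0 v; rewrite scaler0 addr0 scaleN1r addNr.
Qed.

Lemma tens0r u : tens u 0 = 0.
Proof.
by have := tens_linr (-1) u 0 0; rewrite scaler0 addr0 scaleN1r addNr.
Qed.

Lemma tensZl c u v : tens (c *: u) v = c *: tens u v.
Proof. by have := tens_linl c u 0 v; rewrite tens0l !addr0. Qed.

Lemma tensZr c u v : tens u (c *: v) = c *: tens u v.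
Proof. by have := tens_linr c u v 0; rewrite tens0r !addr0. Qed.

Lemma tensDl u u' v : tens (u + u') v = tens u v + tens u' v.
Proof. by have := tens_linl 1 u u' v; rewrite !scale1r. Qed.

Lemma tensDr u v v' : tens u (v + v') = tens u v + tens u v'.
Proof. by have := tens_linr 1 u v v'; rewrite !scale1r. Qed.

Lemma tensor_ind (P : tensor -> Prop) :
  (forall c u v t, P t -> P (c *: tens u v + t)) -> P 0 -> forall t, P t.
Proof.
move=> PD P0 t; rewrite -[t]reprK [repr t]monalgE.
elim: (enum_fset _) => [|[u v] s IH]; first by rewrite big_nil raddf0.
rewrite big_cons raddfD /=.
have -> : \pi_tensor << (repr t)@_(u, v) *g (u, v) >>
          = (repr t)@_(u, v) *: tens u v.
  rewrite tens.unlock -pi_tensorZ; congr (\pi _).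
  by apply/malgP=> k; rewrite !mcoeffsE /= mulr_natr.
exact: PD.
Qed.

End TensTheory.

Definition bilin (R : comNzRingType) (U V W : lmodType R) (f : U -> V -> W) :=
  (forall v, linear (f^~ v)) /\ (forall u, linear (f u)).

(* The linear map out of the tensor product induced by f; this is meaningful
   when f is bilinear, see tensor_liftE and tensor_lift_linear. *)
HB.lock Definition tensor_lift (R : comNzRingType) (U V W : lmodType R)
    (f : U -> V -> W) (t : tensor U V) : W :=
  \sum_(k <- msupp (repr t)) (repr t)@_k *: f k.1 k.2.
Canonical tensor_lift_unlockable := Unlockable tensor_lift.unlock.

Section TensorLift.
Variables (R : comNzRingType) (U V W : lmodType R).

Let pre (f : U -> V -> W) (t : {malg R[(U * V)%type]}) : W :=
  \sum_(k <- msupp t) t@_k *: f k.1 k.2.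

Let preEw f (d : {fset (U * V)%type}) t : (msupp t `<=` d)%fset ->
  pre f t = \sum_(k <- d) t@_k *: f k.1 k.2.
Proof.
move=> le; rewrite [LHS](big_fset_incl _ le) => //= x xd /mcoeff_outdom ->.
by rewrite scale0r.
Qed.

Let preU f (k : (U * V)%type) : pre f << k >> = f k.1 k.2.
Proof. by rewrite (preEw _ (msuppU_le)) big_seq_fset1 mcoeffUU scale1r. Qed.

Let pre_lin f : linear (pre f).
Proof.
move=> c s t.
pose d := (msupp (c *: s + t) `|` msupp s `|` msupp t)%fset.
rewrite !(@preEw _ d) ?scaler_sumr -?big_split /=.
- by apply: eq_bigr => k _; rewrite !mcoeffsE scalerDl scalerA.
- by rewrite /d fsubsetUr.
- by rewrite /d -fsetUA fsetUCA fsubsetUl.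
- by rewrite /d -fsetUA fsubsetUl.
Qed.

Let pre_null f t : bilin f -> bilin_rel t -> pre f t = 0.
Proof.
case=> fl fr; pose F : {linear _ -> _} := HB.pack (pre f)
  (GRing.isLinear.Build _ _ _ _ (pre f) (pre_lin f)).
rewrite -[pre f]/(F : _ -> _).
elim=> [c u u' v|c u v v'||c s t' _ hs _ ht].
- by rewrite !linearB linearZ /= !preU /= fl -addrA -opprD subrr.
- by rewrite !linearB linearZ /= !preU /= fr -addrA -opprD subrr.
- exact: linear0.
- by rewrite linearP hs ht scaler0 addr0.
Qed.

Let tensor_lift_pi f t : bilin f -> tensor_lift f (\pi t) = pre f t.
Proof.
move=> bf; pose F : {linear _ -> _} := HB.pack (pre f)
  (GRing.isLinear.Build _ _ _ _ (pre f) (pre_lin f)).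
rewrite tensor_lift.unlock; apply/eqP; rewrite -subr_eq0 -[\sum_(k <- _) _]/(F _) -[pre f t]/(F _) -linearB.
apply/eqP/(pre_null bf).
suff: repr (\pi_(tensor U V) t) - t \in bilin_null U V by move/asboolP.
by rewrite Quotient.idealrBE reprK.
Qed.

Lemma tensor_liftE (f : U -> V -> W) u v : bilin f -> tensor_lift f (tens u v) = f u v.
Proof. by move=> bf; rewrite tens.unlock tensor_lift_pi // preU. Qed.

Lemma tensor_lift_linear (f : U -> V -> W) : bilin f -> linear (tensor_lift f).
Proof.
move=> bf c s t; rewrite -[s]reprK -[t]reprK.
rewrite -pi_tensorZ -raddfD /=.
by rewrite !tensor_lift_pi // pre_lin.
Qed.

Lemma tensor_lift0 (f : U -> V -> W) : bilin f -> tensor_lift f 0 = 0.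
Proof.
move=> bf; have := tensor_lift_linear bf (-1) 0 0.
by rewrite scaleN1r oppr0 addr0 scaleN1r addNr.
Qed.

End TensorLift.

Section TensorMap2.
Variables (R : comNzRingType) (U1 U2 U3 V1 V2 V3 : lmodType R).
Variables (f : U1 -> U2 -> U3) (g : V1 -> V2 -> V3).

(* (u1 (x) v1, u2 (x) v2) |-> f u1 u2 (x) g v1 v2 *)
Definition tensor_map2 (s : tensor U1 V1) (t : tensor U2 V2) : tensor U3 V3 :=
  tensor_lift (fun u1 v1 =>
    tensor_lift (fun u2 v2 => tens (f u1 u2) (g v1 v2)) t) s.

Hypotheses (bf : bilin f) (bg : bilin g).

Let inner_bilin u1 v1 : bilin (fun u2 v2 => tens (f u1 u2) (g v1 v2)).
Proof.
case: bf bg => _ fr [_ gr].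
by split=> [v|u] c x y; rewrite ?fr ?gr (tens_linl, tens_linr).
Qed.

Let outer_bilin t :
  bilin (fun u1 v1 => tensor_lift (fun u2 v2 => tens (f u1 u2) (g v1 v2)) t).
Proof.
case: bf bg => fl _ [gl _].
split=> [v|u] c x y; move: t; apply: tensor_ind => [a u2 v2 t IH|].
- rewrite !tensor_lift_linear // IH !tensor_liftE // fl tens_linl.
  by rewrite !scalerDr !scalerA [a * c]mulrC addrACA.
- by rewrite !tensor_lift0 // scaler0 addr0.
- rewrite !tensor_lift_linear // IH !tensor_liftE // gl tens_linr.
  by rewrite !scalerDr !scalerA [a * c]mulrC addrACA.
- by rewrite !tensor_lift0 // scaler0 addr0.
Qed.

Lemma tensor_map2E u1 v1 u2 v2 :
  tensor_map2 (tens u1 v1) (tens u2 v2) = tens (f u1 u2) (g v1 v2).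
Proof. by rewrite /tensor_map2 !tensor_liftE. Qed.

Lemma tensor_map2_bilin : bilin tensor_map2.
Proof.
split=> [t|s]; first exact: tensor_lift_linear.
move=> c x y; move: s; apply: tensor_ind => [a u v s IH|].
  rewrite /tensor_map2 in IH *.
  rewrite !tensor_lift_linear // IH !tensor_liftE // tensor_lift_linear //.
  by rewrite !scalerDr !scalerA [a * c]mulrC addrACA.
by rewrite /tensor_map2 !tensor_lift0 // scaler0 addr0.
Qed.

End TensorMap2.

Section IntZ.
Variable X : choiceType.

Notation QX := {malg rat[{cmonom X}]}.

Definition monom_eval (a : X -> rat) (m : {cmonom X}) : rat :=
  \prod_(x <- finsupp m) a x ^+ m x.

Lemma monom_eval_mmorphism a : mmorphism (monom_eval a).
Proof.
have Ew (m : {cmonom X}) (d : {fset X}) : (finsupp m `<=` d)%fset ->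
    monom_eval a m = \prod_(x <- d) a x ^+ m x.
  move=> le; rewrite /monom_eval (big_fset_incl _ le) // => x _.
  by rewrite -cmE_eq0 => /eqP ->.
split=> [m1 m2|]; last by rewrite /monom_eval mdom1 big_seq_fset0.
rewrite (Ew m1 _ (fsubsetUl _ (finsupp m2))) (Ew m2 _ (fsubsetUr (finsupp m1) _)).
rewrite /monom_eval mdomD -big_split; apply: eq_bigr => x _.
by rewrite cmM exprD.
Qed.
HB.instance Definition _ a :=
  isMultiplicative.Build _ _ (monom_eval a) (monom_eval_mmorphism a).

Definition peval (a : X -> rat) (q : QX) : rat := mmap idfun (monom_eval a) q.
HB.instance Definition _ a := GRing.RMorphism.copy (peval a)
  (mmap (idfun : {rmorphism rat -> rat}) (monom_eval a : {mmorphism _ -> _})).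

Definition int_valued : {pred QX} := fun q =>
  `[< forall a : X -> int, peval (fun x => (a x)%:~R) q \is a Num.int >].

Lemma int_valued_subring : subring_closed int_valued.
Proof.
split=> [|p q /asboolP hp /asboolP hq|p q /asboolP hp /asboolP hq];
  apply/asboolP => a.
- by rewrite rmorph1 rpred1.
- by rewrite rmorphB rpredB ?hp ?hq.
- by rewrite rmorphM rpredM ?hp ?hq.
Qed.
HB.instance Definition _ :=
  GRing.isSubringClosed.Build QX int_valued int_valued_subring.

Record IntZ : predArgType := MkIntZ { IntZ_val : QX; _ : IntZ_val \in int_valued }.
HB.instance Definition _ := [isSub for IntZ_val].
HB.instance Definition _ := [Choice of IntZ by <:].
HB.instance Definition _ := [SubChoice_isSubComNzRing of IntZ by <:].

HB.instance Definition _ := GRing.Lmodule.copy IntZ (zmodule IntZ).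
Lemma IntZ_scalerAl (n : int) (x y : IntZ) : n *: (x * y) = n *: x * y.
Proof. by rewrite -[LHS]mulrzAl. Qed.
Lemma IntZ_scalerAr (n : int) (x y : IntZ) : n *: (x * y) = x * (n *: y).
Proof. by rewrite -[LHS]mulrzAr. Qed.
HB.instance Definition _ := GRing.Lmodule_isLalgebra.Build int IntZ IntZ_scalerAl.
HB.instance Definition _ := GRing.Lalgebra_isAlgebra.Build int IntZ IntZ_scalerAr.

Definition evZ (a : X -> int) (q : IntZ) : int :=
  Num.floor (peval (fun x => (a x)%:~R) (val q)).

Lemma evZE a q : (evZ a q)%:~R = peval (fun x => (a x)%:~R) (val q).
Proof. by apply/floorK; case: q => q /= /asboolP. Qed.

Lemma evZ_zmod a : zmod_morphism (evZ a).
Proof.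
by move=> p q; apply: (@intr_inj rat); rewrite rmorphB /= !evZE !rmorphB.
Qed.
HB.instance Definition _ a := GRing.isZmodMorphism.Build _ _ (evZ a) (evZ_zmod a).
Lemma evZ_monoid a : monoid_morphism (evZ a).
Proof.
split=> [|p q]; apply: (@intr_inj rat); first by rewrite evZE !rmorph1.
by rewrite rmorphM /= !evZE !rmorphM.
Qed.
HB.instance Definition _ a :=
  GRing.isMonoidMorphism.Build _ _ (evZ a) (evZ_monoid a).

(* The polynomial x (x - 1) ... (x - n + 1) / n! *)
Definition binomX (x : X) (n : nat) : QX :=
  (n`!%:R)^-1 *: \prod_(i < n) (<< ucm x >> - i%:R).

Lemma peval_binomX a x n :
  peval a (binomX x n) = (n`!%:R)^-1 * \prod_(i < n) (a x - i%:R).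
Proof.
rewrite /binomX -mul_malgC rmorphM rmorph_prod /=.
rewrite {1}/peval mmapC; congr (_ * _).
apply: eq_bigr => i _; rewrite rmorphB rmorph_nat; congr (_ - _).
by rewrite /= /peval mmapU mul1r /monom_eval mdomU big_seq_fset1 cmUU expr1.
Qed.

Lemma binomX_int_valued x n : binomX x n \in int_valued.
Proof.
have natcase (m : nat) :
    (n`!%:R)^-1 * \prod_(i < n) (m%:R - i%:R) = 'C(m, n)%:R :> rat.
  have -> : \prod_(i < n) (m%:R - i%:R) = (m ^_ n)%:R :> rat.
    have [lnm|lmn] := leqP n m.
      rewrite ffact_prod natr_prod; apply: eq_bigr => i _.
      by rewrite natrB // (leq_trans (ltnW (ltn_ord i))).
    by rewrite ffact_small // (bigD1 (Ordinal lmn)) //= subrr mul0r.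
  by rewrite -bin_ffact natrM mulrCA mulVf ?mulr1 // pnatr_eq0 -lt0n fact_gt0.
apply/asboolP => a; rewrite peval_binomX.
case: (a x) => m; first by rewrite natcase rpred_nat.
have -> : \prod_(i < n) ((Negz m)%:~R - i%:R)
    = (-1) ^+ n * \prod_(i < n) ((m + n)%:R - i%:R) :> rat.
  rewrite [in RHS](reindex_inj rev_ord_inj) /= -[X in (-1) ^+ X]card_ord.
  rewrite -prodr_const -big_split /=; apply: eq_bigr => i _.
  have -> : (n - i.+1)%:R = n%:R - i%:R - 1 :> rat by rewrite natrB // -natr1 opprD addrA.
  by rewrite NegzE mulrNz -pmulrn -natr1 natrD; ring.
by rewrite mulrCA natcase rpredM ?rpredX ?rpredN ?rpred1 ?rpred_nat.
Qed.

Definition binomZ x n : IntZ := MkIntZ (binomX_int_valued x n).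

Definition const_term (q : IntZ) : rat := (val q)@_(mone : {cmonom X}).

End IntZ.

Record primeT := PrimeT { prime_val :> nat; prime_valP : prime prime_val }.

Section IntFp.
Variables (X : choiceType) (p : primeT).

(* The ideal of Int(Z^X) generated by the binomials (x choose n), n >= p. *)
Definition binom_ideal : {pred IntZ X} := fun q =>
  `[< exists2 s : seq (IntZ X * X * nat), all (fun t => (p <= t.2)%N) s &
      q = \sum_(t <- s) t.1.1 * binomZ t.1.2 t.2 >].

Definition lift_Fp (a : X -> 'F_p) : X -> int := fun x => (nat_of_ord (a x))%:Z.

Lemma evZ_binomZ_small (a : X -> int) x n (m : nat) :
  a x = m%:Z -> (m < n)%N -> evZ a (binomZ x n) = 0.
Proof.
move=> ax lmn; apply: (@intr_inj rat); rewrite evZE peval_binomX ax.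
by rewrite (bigD1 (Ordinal lmn)) //= subrr mul0r mulr0.
Qed.

Lemma binom_ideal_ev (a : X -> int) q :
  (forall x, exists2 m : nat, a x = m%:Z & (m < p)%N) ->
  q \in binom_ideal -> evZ a q = 0.
Proof.
move=> ha /asboolP[s /allP hs ->]; rewrite rmorph_sum big_seq big1 //= => t ts.
have [m am mp] := ha t.1.2.
by rewrite rmorphM /= (evZ_binomZ_small am) ?mulr0 // (leq_trans mp) ?hs.
Qed.

Lemma lift_Fp_small (a : X -> 'F_p) x : (nat_of_ord (a x) < p)%N.
Proof.
rewrite (leq_trans (ltn_ord _)) // -[in leqRHS](pdiv_id (prime_valP p)).
by rewrite Zp_cast ?pdiv_id ?prime_gt1 ?prime_valP.
Qed.

Lemma binom_ideal_closed : idealr_closed binom_ideal.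
Proof.
split=> [|| c u v /asboolP[s hs ->] /asboolP[t ht ->]].
- by apply/asboolP; exists [::]; rewrite // big_nil.
- apply/negP => /(@binom_ideal_ev (fun=> 0)) h.
  have: evZ (fun=> 0) (1 : IntZ X) = 0.
    by apply: h => x; exists 0%N; rewrite // prime_gt0 ?prime_valP.
  by rewrite rmorph1.
- apply/asboolP; exists ([seq (c * x.1.1, x.1.2, x.2) | x <- s] ++ t).
    by rewrite all_cat all_map ht andbT.
  rewrite big_cat big_map /= mulr_sumr; congr (_ + _).
  by apply: eq_bigr => x _; rewrite mulrA.
Qed.
HB.instance Definition _ := isIdealr.Build _ binom_ideal binom_ideal_closed.

Definition IntZmod : Type := Quotient.quot binom_ideal.
HB.instance Definition _ := GRing.ComNzRing.on IntZmod.
HB.instance Definition _ := NzRingQuotient.on IntZmod.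

(* Int(F_p^X) = (Int(Z^X) / binom_ideal) (x)_Z F_p *)
Definition IntFp : Type := tensor (zmodule IntZmod) (zmodule 'F_p).
HB.instance Definition _ := GRing.Zmodule.on IntFp.

Definition IntFp_tens (b : IntZmod) (s : 'F_p) : IntFp :=
  @tens _ (zmodule IntZmod) (zmodule 'F_p) b s.

Let zmul_bilin (A : comNzRingType) :
  @bilin _ (zmodule A) (zmodule A) (zmodule A) ( *%R : A -> A -> A).
Proof.
split=> [y|x] c u v; rewrite ?scalezrE /=.
  by rewrite (mulrDl (u *~ c : A)) mulrzAl.
by rewrite (mulrDr x (u *~ c : A)) mulrzAr.
Qed.

Definition IntFp_mul : IntFp -> IntFp -> IntFp :=
  @tensor_map2 _ (zmodule IntZmod) (zmodule IntZmod) (zmodule IntZmod)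
    (zmodule 'F_p) (zmodule 'F_p) (zmodule 'F_p)
    ( *%R : IntZmod -> _) ( *%R : 'F_p -> _).

Let mul_bilin : @bilin _ (tensor (zmodule IntZmod) (zmodule 'F_p))
  (tensor (zmodule IntZmod) (zmodule 'F_p))
  (tensor (zmodule IntZmod) (zmodule 'F_p)) IntFp_mul.
Proof. exact: tensor_map2_bilin (zmul_bilin _) (zmul_bilin _). Qed.

Lemma IntFp_mulE b s b' s' :
  IntFp_mul (IntFp_tens b s) (IntFp_tens b' s') = IntFp_tens (b * b') (s * s').
Proof. exact: tensor_map2E (zmul_bilin _) (zmul_bilin _) _ _ _ _. Qed.

Lemma IntFp_ind (P : IntFp -> Prop) :
  (forall b s t, P t -> P (IntFp_tens b s + t)) -> P 0 -> forall t, P t.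
Proof.
move=> PD P0; apply: tensor_ind => // c b s t Pt.
by rewrite -tensZl; exact: PD.
Qed.

Lemma IntFp_tensDl b b' s :
  IntFp_tens (b + b') s = IntFp_tens b s + IntFp_tens b' s.
Proof. exact: tensDl. Qed.
Lemma IntFp_tensDr b s s' :
  IntFp_tens b (s + s') = IntFp_tens b s + IntFp_tens b s'.
Proof. exact: tensDr. Qed.

Lemma IntFp_tens0l s : IntFp_tens 0 s = 0.
Proof. exact: tens0l. Qed.
Lemma IntFp_tens0r b : IntFp_tens b 0 = 0.
Proof. exact: tens0r. Qed.

Let mulDl (x y z : IntFp) :
  IntFp_mul (x + y) z = IntFp_mul x z + IntFp_mul y z.
Proof.
by have := mul_bilin.1 z 1 x y; rewrite !scale1r.
Qed.
Let mulDr (x y z : IntFp) :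
  IntFp_mul x (y + z) = IntFp_mul x y + IntFp_mul x z.
Proof. by have := mul_bilin.2 x 1 y z; rewrite !scale1r. Qed.
Let imul0l (x : IntFp) : IntFp_mul 0 x = 0.
Proof.
by have := mulDl 0 0 x; rewrite addr0 => /eqP; rewrite addrC -subr_eq subrr => /eqP.
Qed.
Let imul0r (x : IntFp) : IntFp_mul x 0 = 0.
Proof.
by have := mulDr x 0 0; rewrite addr0 => /eqP; rewrite addrC -subr_eq subrr => /eqP.
Qed.

Let addr_congr (x x' y : IntFp) : x = x' -> x + y = x' + y.
Proof. by move->. Qed.

Lemma IntFp_mulA : associative IntFp_mul.
Proof.
move=> x y z; elim/IntFp_ind: x => [b s x IH|]; last by rewrite !imul0l.
rewrite !mulDl IH; apply: addr_congr; elim/IntFp_ind: y {IH} => [c r y IH|]; last first.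
  by rewrite imul0l !imul0r imul0l.
rewrite mulDl !mulDr mulDl IH; apply: addr_congr.
elim/IntFp_ind: z {IH} => [d u z IH|]; last by rewrite !imul0r.
by rewrite !mulDr IH !IntFp_mulE !mulrA.
Qed.

Lemma IntFp_mulC : commutative IntFp_mul.
Proof.
move=> x y; elim/IntFp_ind: x => [b s x IH|]; last by rewrite imul0l imul0r.
rewrite mulDl mulDr IH; apply: addr_congr.
elim/IntFp_ind: y {IH} => [c r y IH|]; last by rewrite imul0l imul0r.
by rewrite mulDl mulDr IH !IntFp_mulE mulrC [s * r]mulrC.
Qed.

Lemma IntFp_mul1 : left_id (IntFp_tens 1 1) IntFp_mul.
Proof.
elim/IntFp_ind => [b s x IH|]; last by rewrite imul0r.
by rewrite mulDr IH IntFp_mulE !mul1r.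
Qed.

Definition evIntZmod (a : X -> 'F_p) (b : IntZmod) : 'F_p :=
  (evZ (lift_Fp a) (repr b))%:~R.

Lemma evIntZmod_pi a (q : IntZ X) :
  evIntZmod a (\pi_IntZmod q) = (evZ (lift_Fp a) q)%:~R.
Proof.
apply/eqP; rewrite -subr_eq0 -rmorphB -rmorphB /= binom_ideal_ev ?mulr0z //.
  by move=> x; exists (a x); rewrite // lift_Fp_small.
by rewrite Quotient.idealrBE reprK.
Qed.

Lemma evIntZmodD a b c : evIntZmod a (b + c) = evIntZmod a b + evIntZmod a c.
Proof.
elim/quotW: b => b; elim/quotW: c => c.
by rewrite -rmorphD !evIntZmod_pi !rmorphD.
Qed.
Lemma evIntZmodM a b c : evIntZmod a (b * c) = evIntZmod a b * evIntZmod a c.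
Proof.
elim/quotW: b => b; elim/quotW: c => c.
by rewrite -rmorphM !evIntZmod_pi !rmorphM.
Qed.
Lemma evIntZmod1 a : evIntZmod a 1 = 1.
Proof. by rewrite -(rmorph1 (\pi_IntZmod)) evIntZmod_pi !rmorph1. Qed.
Let evIntZmodMz a b c : evIntZmod a (b *~ c) = evIntZmod a b *~ c.
Proof.
by elim/quotW: b => b; rewrite -rmorphMz !evIntZmod_pi !rmorphMz.
Qed.

(* Evaluation at a : X -> F_p; it is the F_p-algebra morphism sending x to a x,
   see evFp_X.  The binomials (x choose n), n >= p, vanish at the lift of a to
   {0, ..., p - 1}, so evIntZmod does not depend on the representative. *)
Definition evFp (a : X -> 'F_p) (t : IntFp) : 'F_p :=
  @tensor_lift _ (zmodule IntZmod) (zmodule 'F_p) (zmodule 'F_p)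
    (fun b s => evIntZmod a b * s) t.

Let evFp_bilin a : @bilin _ (zmodule IntZmod) (zmodule 'F_p) (zmodule 'F_p)
  (fun b s => evIntZmod a b * s).
Proof.
split=> [s|b] c x y; rewrite ?scalezrE /=.
  by rewrite evIntZmodD evIntZmodMz (mulrDl (_ *~ c)) mulrzAl.
by rewrite (mulrDr _ (_ *~ c : 'F_p)) mulrzAr.
Qed.

Lemma evFp_tens a b s : evFp a (IntFp_tens b s) = evIntZmod a b * s.
Proof. exact: tensor_liftE (evFp_bilin a). Qed.

Lemma evFpD a x y : evFp a (x + y) = evFp a x + evFp a y.
Proof.
by have := tensor_lift_linear (evFp_bilin a) 1 x y; rewrite !scale1r.
Qed.

Lemma evFp0 a : evFp a 0 = 0.
Proof. exact: tensor_lift0 (evFp_bilin a). Qed.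

Lemma IntFp_nonzero1 : IntFp_tens 1 1 != 0.
Proof.
apply/eqP => /(congr1 (evFp (fun=> 0))); rewrite evFp_tens evIntZmod1 evFp0 mulr1.
by move/eqP; rewrite oner_eq0.
Qed.

HB.instance Definition _ := GRing.Zmodule_isComNzRing.Build IntFp
  IntFp_mulA IntFp_mulC IntFp_mul1 mulDl IntFp_nonzero1.

(* Extension of scalars: c *: (b (x) s) = b (x) (c * s). *)
Definition IntFp_scale (c : 'F_p) (t : IntFp) : IntFp :=
  @tensor_lift _ (zmodule IntZmod) (zmodule 'F_p)
    (tensor (zmodule IntZmod) (zmodule 'F_p))
    (fun b s => IntFp_tens b (c * s)) t.

Lemma IntFp_scaleE c t : IntFp_scale c t = IntFp_tens 1 c * t.
Proof.
have bl : @bilin _ (zmodule IntZmod) (zmodule 'F_p)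
    (tensor (zmodule IntZmod) (zmodule 'F_p)) (fun b s => IntFp_tens b (c * s)).
  split=> [s|b] d x y; first exact: tens_linl.
  by rewrite /IntFp_tens ((zmul_bilin _).2 c) tens_linr.
elim/IntFp_ind: t => [b s t IH|]; last by rewrite mulr0; exact: tensor_lift0 bl.
rewrite mulrDr -IH -[_ * _]/(IntFp_mul _ _) IntFp_mulE mul1r.
have -> : IntFp_scale c (IntFp_tens b s + t)
    = IntFp_scale c (IntFp_tens b s) + IntFp_scale c t.
  by have := tensor_lift_linear bl 1 (IntFp_tens b s) t; rewrite !scale1r.
by apply: addr_congr; exact: tensor_liftE bl.
Qed.

Lemma IntFp_scaleA a b t :
  IntFp_scale a (IntFp_scale b t) = IntFp_scale (a * b) t.
Proof.
by rewrite !IntFp_scaleE mulrA -[X in X * t]/(IntFp_mul _ _) IntFp_mulE mulr1.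
Qed.
Lemma IntFp_scale1 : left_id 1 IntFp_scale.
Proof. by move=> t; rewrite IntFp_scaleE mul1r. Qed.
Lemma IntFp_scaleDr : right_distributive IntFp_scale +%R.
Proof. by move=> a s t; rewrite !IntFp_scaleE mulrDr. Qed.
Lemma IntFp_scaleDl t : {morph IntFp_scale^~ t : a b / a + b}.
Proof. by move=> a b; rewrite !IntFp_scaleE IntFp_tensDr mulrDl. Qed.
HB.instance Definition _ := GRing.Zmodule_isLmodule.Build 'F_p IntFp
  IntFp_scaleA IntFp_scale1 IntFp_scaleDr IntFp_scaleDl.

Lemma IntFp_scalerAl (c : 'F_p) (x y : IntFp) : c *: (x * y) = c *: x * y.
Proof. by rewrite /GRing.scale /= !IntFp_scaleE mulrA. Qed.
Lemma IntFp_scalerAr (c : 'F_p) (x y : IntFp) : c *: (x * y) = x * (c *: y).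
Proof. by rewrite /GRing.scale /= !IntFp_scaleE mulrCA. Qed.
HB.instance Definition _ :=
  GRing.Lmodule_isLalgebra.Build 'F_p IntFp IntFp_scalerAl.
HB.instance Definition _ :=
  GRing.Lalgebra_isAlgebra.Build 'F_p IntFp IntFp_scalerAr.

Lemma evFpM a x y : evFp a (x * y) = evFp a x * evFp a y.
Proof.
elim/IntFp_ind: x => [b s x IH|]; last by rewrite mul0r !evFp0 mul0r.
rewrite mulrDl !evFpD mulrDl IH; congr (_ + _).
elim/IntFp_ind: y {IH} => [c r y IH|]; last by rewrite mulr0 !evFp0 mulr0.
rewrite mulrDr !evFpD mulrDr IH; congr (_ + _).
by rewrite -[X in evFp a X]/(IntFp_mul _ _) IntFp_mulE !evFp_tens evIntZmodM mulrACA.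
Qed.

Lemma evFpZ a c x : evFp a (c *: x) = c * evFp a x.
Proof.
by rewrite /GRing.scale /= IntFp_scaleE evFpM evFp_tens evIntZmod1 mul1r.
Qed.

(* The image of a polynomial in Int(Z^X). *)
Definition redFp (q : IntZ X) : IntFp := IntFp_tens (\pi_IntZmod q) 1.

Lemma redFp_zmod : zmod_morphism redFp.
Proof.
move=> q q'; apply/eqP; rewrite eq_sym subr_eq; apply/eqP.
by rewrite -IntFp_tensDl -rmorphD subrK.
Qed.
HB.instance Definition _ := GRing.isZmodMorphism.Build _ _ redFp redFp_zmod.
Lemma redFp_monoid : monoid_morphism redFp.
Proof.
split=> [|q q']; first by rewrite /redFp rmorph1.
by rewrite -[RHS]/(IntFp_mul _ _) IntFp_mulE mulr1 -rmorphM.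
Qed.
HB.instance Definition _ := GRing.isMonoidMorphism.Build _ _ redFp redFp_monoid.

Lemma evFp_red a q : evFp a (redFp q) = (evZ (lift_Fp a) q)%:~R.
Proof. by rewrite evFp_tens evIntZmod_pi mulr1. Qed.

Lemma evFp_X a x : evFp a (redFp (binomZ x 1)) = a x.
Proof.
rewrite evFp_red; have -> : evZ (lift_Fp a) (binomZ x 1) = lift_Fp a x.
  apply: (@intr_inj rat); rewrite evZE peval_binomX.
  by rewrite big_ord_recl big_ord0 subr0 factS fact0 invr1 mul1r mulr1.
by rewrite /lift_Fp -pmulrn natr_Zp.
Qed.

Lemma scale_redFp (c : 'F_p) q :
  c *: redFp q = redFp (q *+ nat_of_ord c).
Proof.
rewrite {1}/GRing.scale /= IntFp_scaleE /redFp.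
rewrite -[LHS]/(IntFp_mul _ _) IntFp_mulE mul1r mulr1 -{1}[c]natr_Zp.
elim: (nat_of_ord c) => [|n IH].
  rewrite !mulr0n raddf0.
  by rewrite IntFp_tens0l IntFp_tens0r.
by rewrite -natr1 IntFp_tensDr IH mulrS raddfD IntFp_tensDl addrC.
Qed.

(* The classes of the polynomials with zero constant term. *)
Definition IntFp_const0 : {pred IntFp} := fun t =>
  `[< exists2 q : IntZ X, const_term q = 0 & t = redFp q >].

Lemma IntFp_const0_submod : submod_closed IntFp_const0.
Proof.
split=> [|c s t /asboolP[q q0 ->] /asboolP[r r0 ->]]; apply/asboolP.
  by exists 0; rewrite ?raddf0 // /const_term raddf0.
exists (q *+ nat_of_ord c + r); last by rewrite scale_redFp raddfD.
by rewrite /const_term !raddfD !raddfMn /= -!/(const_term _) q0 r0 mul0rn addr0.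
Qed.

Lemma IntFp_const0M : {in IntFp_const0 &, forall s t, s * t \in IntFp_const0}.
Proof.
move=> s t /asboolP[q q0 ->] /asboolP[r r0 ->]; apply/asboolP.
exists (q * r); last by rewrite rmorphM.
by rewrite /const_term !rmorphM /= -!/(const_term _) q0 mul0r.
Qed.

Lemma evFp_linear a : linear (evFp a : IntFp -> ('F_p)^o).
Proof. by move=> c s t; rewrite evFpD evFpZ. Qed.

End IntFp.

Definition IntZ_const0 (X : choiceType) : {pred IntZ X} :=
  fun q => const_term q == 0.

Lemma IntZ_const0_submod X : submod_closed (@IntZ_const0 X).
Proof.
split=> [|c s t /eqP s0 /eqP t0]; apply/eqP; first by rewrite /const_term raddf0.
rewrite /const_term !raddfD /= -!/(const_term _) t0 addr0.
by rewrite /const_term !raddfMz /= -!/(const_term _) s0 mul0rz.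
Qed.

Lemma IntZ_const0M X :
  {in @IntZ_const0 X &, forall s t, s * t \in @IntZ_const0 X}.
Proof.
move=> q r /eqP q0 _; apply/eqP.
by rewrite /const_term !rmorphM /= -!/(const_term _) q0 mul0r.
Qed.

Lemma evZ_linear X a : linear (@evZ X a : IntZ X -> int^o).
Proof.
by move=> c s t; rewrite raddfD /= raddfMz /= -mulrzl intz.
Qed.

(* The data attached to (R, X): the algebra Int(R^X), its evaluation maps, and
   the polynomials with zero constant term. *)
Record binom_alg (R : comNzRingType) (X : choiceType) := BinomAlg {
  Int_alg :> comAlgType R;
  evalI : (X -> R) -> Int_alg -> R;
  const0 : {pred Int_alg};
  evalI_linear : forall a, linear (evalI a : Int_alg -> R^o);
  evalIM : forall a, {morph evalI a : q r / q * r};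
  const0_submod : submod_closed const0;
  const0M : {in const0 &, forall q r, q * r \in const0}
}.

Arguments const0 {R X} b _.

Inductive coef := CoefZ | CoefF of primeT.

Definition coef_ring (k : coef) : comNzRingType :=
  match k with CoefZ => int | CoefF p => 'F_p end.

Definition IntR (k : coef) (X : choiceType) : binom_alg (coef_ring k) X :=
  match k with
  | CoefZ => @BinomAlg int X (IntZ X) (@evZ X) (@IntZ_const0 X)
      (@evZ_linear X) (fun a => rmorphM (evZ a))
      (@IntZ_const0_submod X) (@IntZ_const0M X)
  | CoefF p => @BinomAlg 'F_p X (IntFp X p) (@evFp X p) (@IntFp_const0 X p)
      (@evFp_linear X p) (@evFpM X p)
      (@IntFp_const0_submod X p) (@IntFp_const0M X p)
  end.

HB.instance Definition _ R X (A : binom_alg R X) :=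
  GRing.isSubmodClosed.Build R A (const0 A) (const0_submod A).

Section TruncatedTensorAlgebra.
Variables (R : comNzRingType) (X : choiceType) (A : binom_alg R X).

(* The module m_{X,R}. *)
Record mX : predArgType := MX { mX_val : A; _ : mX_val \in const0 A }.
HB.instance Definition _ := [isSub for mX_val].
HB.instance Definition _ := [Choice of mX by <:].
HB.instance Definition _ := [SubChoice_isSubLmodule of mX by <:].

Definition T2 : lmodType R := tensor mX mX.

Definition Tle2 : lmodType R := (R^o * mX * T2)%type.

(* The product of the tensor algebra modulo tensors of degree > 2. *)
Definition Tcup (u v : Tle2) : Tle2 :=
  (u.1.1 * v.1.1,
   u.1.1 *: v.1.2 + v.1.1 *: u.1.2,
   u.1.1 *: v.2 + tens u.1.2 v.1.2 + v.1.1 *: u.2).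

Definition Tcup1_11 (q r : mX) : mX :=
  MX (const0M (valP q) (valP r)).

Definition Tcup1_21 (t : T2) (r : mX) : T2 :=
  tensor_lift (fun a b : mX => tens (Tcup1_11 a r) b + tens a (Tcup1_11 b r)) t.

Definition Tcirc : T2 -> T2 -> T2 := tensor_map2 Tcup1_11 Tcup1_11.

Lemma Tcup1_11_bilin : bilin Tcup1_11.
Proof.
split=> [r|q] c x y; apply: val_inj => /=.
  by rewrite mulrDl scalerAl.
by rewrite mulrDr scalerAr.
Qed.

Lemma Tcup1_21E a b c :
  Tcup1_21 (tens a b) c = tens (Tcup1_11 a c) b + tens a (Tcup1_11 b c).
Proof.
apply: tensor_liftE; split=> [b'|a'] d x y.
  by rewrite Tcup1_11_bilin.1 !tens_linl scalerDr addrACA.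
by rewrite Tcup1_11_bilin.1 !tens_linr scalerDr addrACA.
Qed.

Lemma Tcirc_tens a1 a2 b1 b2 :
  Tcirc (tens a1 a2) (tens b1 b2) = tens (Tcup1_11 a1 b1) (Tcup1_11 a2 b2).
Proof. exact: tensor_map2E Tcup1_11_bilin Tcup1_11_bilin _ _ _ _. Qed.

End TruncatedTensorAlgebra.

(* 2-dimensional Delta-sets.  For a triangle t with ordered vertices 0, 1, 2,
   front t, third t and back t are the edges 01, 02 and 12. *)
Record dset2 := DSet2 {
  vertex : Type;
  edge : Type;
  triangle : Type;
  src : edge -> vertex;
  tgt : edge -> vertex;
  front : triangle -> edge;
  back : triangle -> edge;
  third : triangle -> edge;
  front_back : forall t, tgt (front t) = src (back t);
  front_third : forall t, src (front t) = src (third t);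
  back_third : forall t, tgt (back t) = tgt (third t)
}.

Section Cochains.
Variables (R : comNzRingType) (D : dset2).

Definition C0 : lmodType R := vertex D -> R^o.
Definition C1 : lmodType R := edge D -> R^o.
Definition C2 : lmodType R := triangle D -> R^o.

Definition cochains : lmodType R := (C0 * C1 * C2)%type.

Definition cobound (u : cochains) : cochains :=
  (0 : C0,
   (fun e => u.1.1 (tgt e) - u.1.1 (src e)) : C1,
   (fun t => u.1.2 (back t) - u.1.2 (third t) + u.1.2 (front t)) : C2).

Lemma coboundK u : cobound (cobound u) = 0.
Proof.
congr (_, _, _); apply/funext => s /=; first exact: subrr.
have E (a b c : R) : a - b - (a - c) + (b - c) = 0 by ring.
by rewrite front_back front_third back_third; exact: E.
Qed.

Definition cup_11 (f g : C1) : C2 := fun t => f (front t) * g (back t).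

Definition cup (u v : cochains) : cochains :=
  ((fun x => u.1.1 x * v.1.1 x) : C0,
   (fun e => u.1.1 (src e) * v.1.2 e + u.1.2 e * v.1.1 (tgt e)) : C1,
   (fun t => u.1.1 (src (front t)) * v.2 t + cup_11 u.1.2 v.1.2 t
             + u.2 t * v.1.1 (tgt (back t))) : C2).

Definition cup1_11 (f g : C1) : C1 := fun e => f e * g e.

(* Steenrod's formula in degrees (2, 1); on products of 1-cochains it is the
   one given by the Hirsch identity, see hirsch. *)
Definition cup1_21 (w : C2) (h : C1) : C2 :=
  fun t => w t * (h (front t) + h (back t)).

Lemma hirsch f g h :
  cup1_21 (cup_11 f g) h = cup_11 f (cup1_11 g h) + cup_11 (cup1_11 f h) g.
Proof.
apply/funext => t; rewrite /cup1_21 /cup_11 /cup1_11 /= [RHS]/GRing.add /=.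
by rewrite mulrDr addrC mulrA mulrAC.
Qed.

Definition circ (v w : C2) : C2 := fun t => v t * w t.

End Cochains.

Section Psi.
Variables (R : comNzRingType) (X : choiceType) (A : binom_alg R X).
Variable mu : (X -> R) -> (X -> R) -> (X -> R).

Definition Delta2 : dset2 :=
  @DSet2 unit (X -> R) ((X -> R) * (X -> R))
    (fun=> tt) (fun=> tt) fst snd (fun s => mu s.1 s.2)
    (fun=> erefl) (fun=> erefl) (fun=> erefl).

Definition Cmu : lmodType R := cochains R Delta2.

Definition psi0 (r : R^o) : C0 R Delta2 := fun=> r.
Definition psi1 (q : mX A) : C1 R Delta2 := fun a => evalI a (val q).
Definition psi2 (t : T2 A) : C2 R Delta2 :=
  tensor_lift (fun q q' => (fun s => evalI s.1 (val q) * evalI s.2 (val q'))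
                           : C2 R Delta2) t.

Definition psi (u : Tle2 A) : Cmu := (psi0 u.1.1, psi1 u.1.2, psi2 u.2).

Lemma psi2_tens q q' a a' :
  psi2 (tens q q') (a, a') = evalI a (val q) * evalI a' (val q').
Proof.
rewrite /psi2 tensor_liftE //; split=> [v|u] c x y; apply/funext => s /=.
  by rewrite evalI_linear mulrDl -mulrA.
by rewrite evalI_linear mulrDr mulrCA.
Qed.

End Psi.

Arguments psi0 {R X} mu r.
Arguments psi1 {R X A} mu q.
Arguments psi2 {R X A} mu t.
Arguments psi {R X} A mu u.

(* Main.v *)
Require Import Defs.
From HB Require Import structures.
From mathcomp Require Import all_boot all_order all_algebra.
From mathcomp Require Import finmap boolp functions.
From mathcomp.multinomials Require Import monalg.

(** Everything but injectivity is a check on pure tensors.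

    A polynomial of Int(Z^X) vanishing at all integer points is zero because
    monomials are distinct multiplicative characters, hence independent.  An
    element of Int(F_p^X) vanishing at all points is zero by Newton interpolation,
    one variable at a time: modulo the binomials of index at least p, a polynomial
    is a combination of its specializations x := 0, ..., p - 1.

    In degree 2, let [sum_l u_l (x) v_l] vanish at all pairs of points.  If some
    evaluation a has [c_l = u_l(a)] not all zero, then [sum_l c_l v_l = 0]; write c
    as a multiple of a row of an invertible matrix (Smith normal form over Z,
    Gaussian elimination over F_p).  After the corresponding change of basis, one
    of the v's is zero, and the number of terms drops. *)

Set Implicit Arguments.
Unset Strict Implicit.
Unset Printing Implicit Defensive.

Import GRing.Theory Num.Theory.
Local Open Scope ring_scope.
Local Open Scope quotient_scope.

(** * Integer-valued polynomials and their values *)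

Section IntegerValuedPolynomials.
Variable X : choiceType.
Notation QX := {malg rat[{cmonom X}]}.

Lemma pevalE (a : X -> rat) (q : QX) :
  peval a q = \sum_(m <- msupp q) q@_m * monom_eval a m.
Proof. by rewrite /peval mmapE. Qed.

Lemma monom_evalM (a b : X -> rat) (m : {cmonom X}) :
  monom_eval (fun x => a x * b x) m = monom_eval a m * monom_eval b m.
Proof. by rewrite /monom_eval -big_split; apply: eq_bigr => x _; rewrite exprMn. Qed.

(** These points separate monomials: distinct ones differ in the exponent of some [x], hence in the
    power of 2. *)
Lemma monom_eval_spike (x : X) (m : {cmonom X}) :
  monom_eval (fun y => if y == x then 2 else 1) m = 2 ^+ m x.
Proof.
have E (y : X) : (if y == x then 2 else 1 : rat) ^+ m y = if y == x then 2 ^+ m x else 1.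
  by case: eqP => [->//|_]; rewrite expr1n.
rewrite /monom_eval (eq_bigr _ (fun y _ => E y)).
have [xm|xm] := boolP (x \in finsupp m).
  rewrite (big_fsetD1 x) //= eqxx big1_fset ?mulr1 // => y.
  by rewrite !inE => /andP[/negPf->].
rewrite (fsfun_dflt xm) big1_fset // => y ym _; case: eqP => // yx.
Qed.

(* Dedekind's argument: monomials are pairwise distinct characters of the
   multiplicative monoid of integer points. *)
Lemma monom_eval_free (s : seq {cmonom X}) (c : {cmonom X} -> rat) :
  uniq s ->
  (forall a : X -> int, \sum_(m <- s) c m * monom_eval (fun x => (a x)%:~R) m = 0) ->
  {in s, forall m, c m = 0}.
Proof.
elim: s c => // m0 s IH c /= /andP[m0s us] c0.
have cs : {in s, forall m, c m = 0}.
  move=> m ms.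
  have /eqP/cmP/existsNP[x nx] : m <> m0 by move=> E; rewrite E (negPf m0s) in ms.
  have : c m * (2 ^+ m x - 2 ^+ m0 x) = 0.
    apply: (IH (fun m => c m * (2 ^+ m x - 2 ^+ m0 x))) => // a.
    pose b y : int := a y * (if y == x then 2 else 1).
    have bE m' : monom_eval (fun y => (b y)%:~R) m'
        = monom_eval (fun y => (a y)%:~R) m' * 2 ^+ m' x.
      rewrite -monom_eval_spike -monom_evalM; congr monom_eval.
      by apply/funext => y; rewrite rmorphM /=; case: ifP.
    (* Doubling coordinate [x] scales each monomial by [2 ^+ m x]; subtracting [2 ^+ m0 x] times the
       relation at [a] cancels the [m0] term. *)
    transitivity (\sum_(m <- m0 :: s) c m * monom_eval (fun y => (b y)%:~R) m
      - 2 ^+ m0 x * \sum_(m <- m0 :: s) c m * monom_eval (fun y => (a y)%:~R) m).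
      rewrite mulr_sumr -sumrB big_cons bE mulrA mulrC subrr add0r.
      by apply: eq_bigr => m' _; rewrite bE mulrAC mulrBr mulrA [X in _ - X]mulrC.
    by rewrite !c0 mulr0 subr0.
  move/eqP; rewrite mulf_eq0 subr_eq0 => /orP[/eqP //|].
  by rewrite (inj_eq (ieexprIn _ _)) // => /eqP.
move=> m; rewrite inE => /orP[/eqP->|]; last exact: cs.
(* All other coefficients vanish, and every monomial is 1 at the all-ones point. *)
have := c0 (fun=> 1); rewrite big_cons big_seq big1 => [|m' /cs->]; last by rewrite mul0r.
rewrite addr0 => <-; rewrite /monom_eval big1 ?mulr1 // => x _.
by rewrite expr1n.
Qed.

Lemma evZ_inj (q : IntZ X) : (forall a, evZ a q = 0) -> q = 0.
Proof.
move=> q0; apply: val_inj; apply/malgP => m; rewrite mcoeff0.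
have [ms|ms] := boolP (m \in msupp (val q)); last exact: mcoeff_outdom.
apply: (@monom_eval_free (msupp (val q))) ms => [|a]; first exact: fset_uniq.
by rewrite -pevalE -evZE q0.
Qed.

(* Induction over polynomial functions rather than polynomials avoids factoring
   the monomials of {cmonom X} into variables. *)
Lemma peval_ind (P : ((X -> rat) -> rat) -> Prop) :
  (forall c, P (fun=> c)) -> (forall x, P (fun a => a x)) ->
  (forall f g, P f -> P g -> P (fun a => f a + g a)) ->
  (forall f g, P f -> P g -> P (fun a => f a * g a)) ->
  forall q : QX, P (fun a => peval a q).
Proof.
move=> PC PX PD PM q.
have PXn f n : P f -> P (fun a => f a ^+ n).
  move=> Pf; elim: n => [|n IH]; first by under eq_fun do rewrite expr0.
  by under eq_fun do rewrite exprS; exact: PM.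
under eq_fun do rewrite pevalE; elim: (enum_fset _) => [|m s IH].
  by under eq_fun do rewrite big_nil.
under eq_fun do rewrite big_cons; apply/PD/IH/PM => //.
rewrite /monom_eval; elim: (enum_fset _) => [|x t IHt].
  by under eq_fun do rewrite big_nil.
by under eq_fun do rewrite big_cons; exact/PM/IHt/PXn.
Qed.

(** * Specialization, dependence and degree in one variable *)

Definition upd (R : Type) (a : X -> R) (x : X) (k : R) : X -> R :=
  fun y => if y == x then k else a y.

Lemma upd_intr (a : X -> int) x k :
  (fun y => (upd a x k y)%:~R) = upd (fun y => (a y)%:~R) x k%:~R :> (X -> rat).
Proof. by apply/funext => y; rewrite /upd; case: ifP. Qed.

Lemma upd_id (R : Type) (a : X -> R) x : upd a x (a x) = a.
Proof. by apply/funext => y; rewrite /upd; case: eqP => // ->. Qed.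

(** Substituting an integer keeps a polynomial integer-valued: its values are values of [q] at other
    integer points. *)
Lemma subst_ex (q : IntZ X) x (k : int) :
  exists r : IntZ X, forall a, evZ a r = evZ (upd a x k) q.
Proof.
pose P (f : (X -> rat) -> rat) := exists r : QX, forall a, peval a r = f (upd a x k%:~R).
have [r rE] : P (fun a => peval a (val q)).
  apply: peval_ind => [c|y|f g [r rE] [s sE]|f g [r rE] [s sE]].
  - by exists c%:MP => a; rewrite /peval mmapC.
  - pose v z : QX := << ucm z >>.
    have vE a z : peval a (v z) = a z.
      by rewrite /peval mmapU mul1r /monom_eval mdomU big_seq_fset1 cmUU expr1.
    exists (if y == x then k%:~R else v y) => a; rewrite /upd.
    by case: ifP => _; rewrite ?rmorph_int ?vE.
  - by exists (r + s) => a; rewrite rmorphD /= rE sE.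
  - by exists (r * s) => a; rewrite rmorphM /= rE sE.
have rint : r \in @int_valued X.
  by apply/asboolP => a; rewrite rE -upd_intr -evZE intr_int.
exists (MkIntZ rint) => a; apply: (@intr_inj rat).
by rewrite !evZE rE upd_intr.
Qed.

Definition depends_on (S : {fset X}) (q : IntZ X) : Prop :=
  forall a b, {in S, a =1 b} -> evZ a q = evZ b q.

Lemma depends_on_ex q : exists S, depends_on S q.
Proof.
pose P (f : (X -> rat) -> rat) := exists S : {fset X}, forall a b, {in S, a =1 b} -> f a = f b.
have [S SE] : P (fun a => peval a (val q)).
  apply: peval_ind => [c|x|f g [S SE] [T TE]|f g [S SE] [T TE]].
  - by exists fset0.
  - by exists [fset x]%fset => a b; apply; rewrite inE.
  - exists (S `|` T)%fset => a b ab.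
    by rewrite (SE a b) 1?(TE a b) // => x xS; apply: ab; rewrite inE xS ?orbT.
  - exists (S `|` T)%fset => a b ab.
    by rewrite (SE a b) 1?(TE a b) // => x xS; apply: ab; rewrite inE xS ?orbT.
exists S => a b ab; apply: (@intr_inj rat); rewrite !evZE; apply: SE => x xS.
by rewrite ab.
Qed.

(** One bound serves all lines in direction [x]; on each line, roots of a one-variable polynomial
    can be counted. *)
Definition degree_lt (x : X) (n : nat) (q : IntZ X) : Prop :=
  forall a, exists2 P : {poly rat}, (size P <= n)%N &
    forall k : int, P.[k%:~R] = (evZ (upd a x k) q)%:~R.

Lemma degree_lt_ex x q : exists n, degree_lt x n q.
Proof.
pose P (f : (X -> rat) -> rat) := exists n, forall a, exists2 P : {poly rat},
  (size P <= n)%N & forall k, P.[k] = f (upd a x k).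
have [n nE] : P (fun a => peval a (val q)).
  apply: peval_ind => [c|y|f g [n nE] [m mE]|f g [n nE] [m mE]].
  - by exists 1%N => a; exists c%:P => [|k]; rewrite ?size_polyC_leq1 ?hornerC.
  - exists 2%N => a; exists (if y == x then 'X else (a y)%:P).
      by case: ifP; rewrite ?size_polyX // (leq_trans (size_polyC_leq1 _)).
    by move=> k; rewrite /upd; case: ifP; rewrite ?hornerX ?hornerC.
  - exists (maxn n m) => a; have [A sA EA] := nE a; have [B sB EB] := mE a.
    exists (A + B) => [|k]; last by rewrite hornerD EA EB.
    by rewrite (leq_trans (size_polyD _ _)) // geq_max !leq_max sA sB orbT.
  - exists (n + m)%N => a; have [A sA EA] := nE a; have [B sB EB] := mE a.
    exists (A * B) => [|k]; last by rewrite hornerM EA EB.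
    by rewrite (leq_trans (size_polyMleq _ _)) // (leq_trans (leq_pred _)) // leq_add.
exists n => a; have [A sA EA] := nE (fun y => (a y)%:~R).
by exists A => // k; rewrite EA evZE upd_intr.
Qed.

Lemma degree_ltW x m n q : (m <= n)%N -> degree_lt x m q -> degree_lt x n q.
Proof. by move=> mn qm a; have [P sP PE] := qm a; exists P => //; exact: leq_trans mn. Qed.

Lemma degree_lt_sub x n q r :
  degree_lt x n q -> degree_lt x n r -> degree_lt x n (q - r).
Proof.
move=> qn rn a; have [A sA AE] := qn a; have [B sB BE] := rn a.
exists (A - B) => [|k]; last by rewrite hornerD hornerN AE BE rmorphB rmorphB.
by rewrite (leq_trans (size_polyD _ _)) // size_polyN geq_max sA.
Qed.

Lemma degree_lt_binomM x n r : (forall a k, evZ (upd a x k) r = evZ a r) ->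
  degree_lt x n.+1 (binomZ x n * r).
Proof.
move=> rE a; exists (((n`!%:R)^-1 * (evZ a r)%:~R) *: \prod_(i < n) ('X - i%:R%:P)).
  apply: leq_trans (size_scale_leq _ _) _.
  by rewrite size_prod_XsubC /index_enum -enumT size_enum_ord.
move=> k; rewrite hornerZ rmorphM rmorphM /= rE mulrAC; congr (_ * _).
rewrite evZE peval_binomX horner_prod /upd eqxx; congr (_ * _).
by apply: eq_bigr => i _; rewrite hornerXsubC.
Qed.

(** On each line in direction [x], a polynomial of degree below [n] has the [n] distinct roots
    [0, ..., n - 1]. *)
Lemma degree_lt_eq0 x n q : degree_lt x n q ->
  (forall a (k : nat), (k < n)%N -> evZ (upd a x k%:Z) q = 0) -> q = 0.
Proof.
move=> qn q0; apply: evZ_inj => a; have [P sP PE] := qn a.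
have P0 : P = 0.
  apply: (@roots_geq_poly_eq0 _ _ [seq i%:R | i <- iota 0 n]).
  - rewrite all_map; apply/allP => i; rewrite mem_iota /= add0n => lin.
    by rewrite /root -[i%:R]/((i%:Z)%:~R) PE q0.
  - by rewrite map_inj_uniq ?iota_uniq //; exact: (mulrIn (oner_neq0 _)).
  - by rewrite size_map size_iota.
by apply: (@intr_inj rat); rewrite -{1}(upd_id a x) -PE P0 horner0.
Qed.

Lemma evZ_binomZ_diag (a : X -> int) x n : a x = n%:Z -> evZ a (binomZ x n) = 1.
Proof.
move=> ax; apply: (@intr_inj rat); rewrite evZE peval_binomX ax.
have -> : \prod_(i < n) ((n%:Z)%:~R - i%:R) = n`!%:R :> rat.
  rewrite -ffactnn ffact_prod natr_prod; apply: eq_bigr => i _.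
  by rewrite natrB // ltnW.
by rewrite mulVf // pnatr_eq0 -lt0n fact_gt0.
Qed.

End IntegerValuedPolynomials.

(** * Reduction modulo p and Newton interpolation *)

Section ReductionModP.
Variables (X : choiceType) (p : primeT).

Lemma redFp_binomZ (x : X) n : (p <= n)%N -> redFp p (binomZ x n) = 0.
Proof.
move=> pn; rewrite /redFp.
have -> : \pi_(IntZmod X p) (binomZ x n) = 0; last exact: IntFp_tens0l.
rewrite -(rmorph0 (\pi_(IntZmod X p))); apply/eqP.
rewrite -Quotient.idealrBE subr0; apply/asboolP.
by exists [:: (1, x, n)]; rewrite /= ?pn // big_seq1 mul1r.
Qed.

Lemma redFp_intmul (z : int) (q : IntZ X) :
  (z%:~R : 'F_p) = 0 -> redFp p (z%:~R * q) = 0.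
Proof. by move=> z0; rewrite mulrzl raddfMz -scaler_int z0 scale0r. Qed.

Lemma evFp_redFp_eq0 (q : IntZ X) (a : X -> 'F_p) :
  redFp p q = 0 -> (evZ (lift_Fp a) q)%:~R = 0 :> 'F_p.
Proof. by move=> q0; rewrite -evFp_red q0 evFp0. Qed.

(** For [n < p] the integer [n] is the chosen lift of its class, so substituting it stays among
    lifts of points over F_p. *)
Lemma upd_lift_Fp (a : X -> 'F_p) x (n : nat) : (n < p)%N ->
  upd (lift_Fp a) x n%:Z = lift_Fp (upd a x (n%:R)).
Proof.
move=> np; apply/funext => y; rewrite /lift_Fp /upd; case: ifP => // _.
by rewrite val_Fp_nat ?prime_valP // modn_small.
Qed.

(* Newton interpolation in one variable [x], carried out inside the kernel of
   the reduction: the coefficients of the binomials of index below [p] are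
   killed by induction on the set of variables, the other binomials by
   definition. *)
Lemma redFp_eq0 (q : IntZ X) :
  (forall a : X -> 'F_p, (evZ (lift_Fp a) q)%:~R = 0 :> 'F_p) -> redFp p q = 0.
Proof.
have [S] := depends_on_ex q.
elim/finSet_rect: S q => S IHS q qS q0.
have [S0|[x xS]] := fset_0Vmem S.
  (* Without variables, [q] is the constant given by its value at the lift of 0, which is 0 modulo
     [p]. *)
  have -> : q = (evZ (lift_Fp (fun=> 0 : 'F_p)) q)%:~R * 1.
    apply/eqP; rewrite -subr_eq0; apply/eqP/evZ_inj => a.
    rewrite raddfB /= mulr1 rmorph_int intz; apply/eqP; rewrite subr_eq0; apply/eqP.
    by apply: qS => y; rewrite S0 inE.
  exact: redFp_intmul.
have SxS : (S `\ x `<` S)%fset by exact: fproperD1.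
(* [s] is the sum of the first [n] Newton terms; it agrees with [q] at the nodes
   [x = 0, ..., n - 1]. *)
have newton n : exists s : IntZ X, [/\ depends_on S s, redFp p s = 0,
    degree_lt x n s & forall a (k : nat), (k < n)%N ->
      evZ (upd a x k%:Z) s = evZ (upd a x k%:Z) q].
  elim: n => [|n [s [sS s0 sn sE]]].
    exists 0; split=> //; rewrite ?raddf0 //; first by move=> a b _; rewrite !raddf0.
    by move=> a; exists 0; rewrite ?size_poly0 // => k; rewrite horner0 raddf0.
  (* The next Newton coefficient is the error of [s] at node [n]; it no longer involves [x]. *)
  have [r rE] := subst_ex (q - s) x n%:Z.
  have rS : depends_on (S `\ x)%fset r.
    move=> a b ab; rewrite !rE !raddfB /=.
    have ab' : {in S, upd a x n%:Z =1 upd b x n%:Z}.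
      move=> y yS; rewrite /upd; case: eqP => // /eqP yx.
      by apply: ab; rewrite !inE yx.
    by rewrite (qS _ _ ab') (sS _ _ ab').
  have rx a k : evZ (upd a x k) r = evZ a r.
    by rewrite !rE; congr evZ; apply/funext => y; rewrite /upd; case: (y == x).
  exists (s + binomZ x n * r); split.
  - move=> a b ab; rewrite !rmorphD !rmorphM /= (sS a b ab).
    rewrite (rS a b) => [|y]; last by rewrite !inE => /andP[_ /ab].
    congr (_ + _ * _); apply: (@intr_inj rat); rewrite !evZE !peval_binomX.
    by rewrite ab.
  - rewrite rmorphD rmorphM /= s0 add0r.
    have [pn|np] := leqP p n; first by rewrite redFp_binomZ // mul0r.
    (* At lifts, [r] takes values of [q - s] at lifts, which vanish modulo [p]. *)
    rewrite (IHS _ SxS r rS) ?mulr0 // => a.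
    rewrite rE upd_lift_Fp // raddfB /= rmorphB /= q0 evFp_redFp_eq0 //.
    by rewrite subr0.
  - rewrite -[binomZ x n * r]opprK; apply: degree_lt_sub; first exact: degree_ltW sn.
    rewrite -mulrN; apply: degree_lt_binomM => a k.
    by rewrite !raddfN /= rx.
  (* At node [n] the binomial is 1 and [r] corrects the error; at earlier nodes the binomial
     vanishes. *)
  - move=> a k; rewrite ltnS leq_eqVlt => /orP[/eqP->|kn].
      rewrite rmorphD rmorphM /= evZ_binomZ_diag; last by rewrite /upd eqxx.
      by rewrite mul1r rx rE raddfB /= addrC subrK.
    rewrite rmorphD rmorphM /= sE // (@evZ_binomZ_small _ _ _ _ k) //.
      by rewrite mul0r addr0.
    by rewrite /upd eqxx.
(* Once [n] exceeds the degree of [q] in [x], the interpolant is [q] itself. *)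
have [n qn] := degree_lt_ex x q; have [s [_ s0 sn sE]] := newton n.
have /eqP : q - s = 0.
  apply: (@degree_lt_eq0 _ x n); first exact: degree_lt_sub.
  by move=> a k kn; rewrite raddfB /= sE // subrr.
by rewrite subr_eq0 => /eqP->.
Qed.

End ReductionModP.

(** * Primitive rows over the integers and over fields *)

(* Every row is a multiple of a row of an invertible matrix; [Q] stands for the
   inverse of [P], as [R] need not carry a [comUnitRingType] structure. *)
Definition has_primitive_rows (R : comNzRingType) : Prop :=
  forall n (c : 'rV[R]_n.+1), exists d (P Q : 'M_n.+1),
    Q *m P = 1%:M /\ c = d *: row 0 P.

Lemma mul_delta_row (R : comNzRingType) n (L : 'M[R]_1) e (P : 'M_n.+1) :
  L *m (e *: delta_mx 0 0) *m P = (L 0 0 * e) *: row 0 P.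
Proof. by rewrite [L]mx11_scalar mul_scalar_mx !mxE mulr1n scalerA -scalemxAl -rowE. Qed.

Lemma int_has_primitive_rows : has_primitive_rows int.
Proof.
move=> n c; have [L _ [P Pu [d _ ->]]] := int_Smith_normal_form c.
exists (L 0 0 * d`_0), P, (invmx P); split; first exact: mulVmx.
rewrite -mul_delta_row; congr (_ *m _ *m _); apply/matrixP => i j.
by rewrite !mxE !ord1 /= mulr_natr eq_sym.
Qed.

Lemma field_has_primitive_rows (F : fieldType) : has_primitive_rows F.
Proof.
(* The factor [0 < \rank c] is the corner entry of the rank normal form of [c], whose other entries
   are 0. *)
move=> n c; exists (col_ebase c 0 0 * (0 < \rank c)%N%:R), (row_ebase c), (invmx (row_ebase c)).
split; first by rewrite mulVmx // row_ebase_unit.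
rewrite -mul_delta_row -{1}[c]mulmx_ebase; congr (_ *m _ *m _).
apply/matrixP => i j; rewrite !mxE !ord1 /= -natrM mulnb andbC.
by rewrite [in LHS]eq_sym.
Qed.

(** * Tensors separated by pairs of functionals *)

Section TensorSeparation.
Variables (R : comNzRingType) (U V : lmodType R).

Lemma tens_suml n (u : 'I_n -> U) (v : V) : tens (\sum_i u i) v = \sum_i tens (u i) v.
Proof. exact: (big_morph (fun u => tens u v) (fun x y => tensDl x y v) (tens0l U v)). Qed.

Lemma tens_sumr n (u : U) (v : 'I_n -> V) : tens u (\sum_i v i) = \sum_i tens u (v i).
Proof. exact: (big_morph (fun v => tens u v) (tensDr u) (tens0r V u)). Qed.

Lemma tensor_sumE (t : tensor U V) :
  exists n (u : 'I_n -> U) (v : 'I_n -> V), t = \sum_i tens (u i) (v i).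
Proof.
move: t; apply: tensor_ind => [c u0 v0 _ [n [u [v ->]]]|].
  exists n.+1, (fun i => oapp u (c *: u0) (unlift ord0 i)).
  exists (fun i => oapp v v0 (unlift ord0 i)).
  rewrite big_ord_recl !unlift_none /= tensZl; congr (_ + _).
  by apply: eq_bigr => i _; rewrite !liftK.
by exists 0%N, (fun=> 0), (fun=> 0); rewrite big_ord0.
Qed.

(** Moving all scalars out of the tensors leaves the entries of [Q *m P] as coefficients. *)
Lemma tens_change_basis n (u : 'I_n -> U) (v : 'I_n -> V) (P Q : 'M[R]_n) :
  Q *m P = 1%:M ->
  \sum_j tens (\sum_l Q l j *: u l) (\sum_k P j k *: v k) = \sum_l tens (u l) (v l).
Proof.
move=> QP.
transitivity (\sum_j \sum_l \sum_k (Q l j * P j k) *: tens (u l) (v k)).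
  apply: eq_bigr => j _; rewrite tens_suml; apply: eq_bigr => l _.
  rewrite tens_sumr; apply: eq_bigr => k _.
  by rewrite tensZl tensZr scalerA.
rewrite exchange_big; apply: eq_bigr => l _; rewrite exchange_big /=.
transitivity (\sum_k (1%:M : 'M[R]_n) l k *: tens (u l) (v k)).
  by apply: eq_bigr => k _; rewrite -QP mxE scaler_suml.
rewrite (bigD1 l) //= mxE eqxx scale1r big1 ?addr0 // => k kl.
by rewrite mxE eq_sym (negPf kl) scale0r.
Qed.

Variables I J : Type.
Variables (f : I -> {linear U -> R^o}) (g : J -> {linear V -> R^o}).
Variable h : I -> J -> {linear tensor U V -> R^o}.
Hypothesis hE : forall i j u v, h i j (tens u v) = f i u * g j v.
Hypothesis R_domain : forall x y : R, x * y = 0 -> x = 0 \/ y = 0.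
Hypothesis R_rows : has_primitive_rows R.
Hypothesis f_sep : forall u, (forall i, f i u = 0) -> u = 0.
Hypothesis g_sep : forall v, (forall j, g j v = 0) -> v = 0.

(* Induction on the number of terms: a functional [f i] not killing all the left
   factors gives a relation [sum c_l v_l = 0], and a unimodular change of basis
   turns the primitive part of this relation into the vanishing of one right
   factor. *)
Lemma tensor_separated (t : tensor U V) : (forall i j, h i j t = 0) -> t = 0.
Proof.
have [n [u [v ->]]] := tensor_sumE t.
elim: n u v => [|n IH] u v h0; first by rewrite big_ord0.
have [[i [l fl]]|f0] := pselect (exists i l, f i (u l) <> 0); last first.
  apply: big1 => l _; rewrite [u l]f_sep ?tens0l // => i.
  by apply: contrapT => fl; apply: f0; exists i, l.
have [d [P [Q [QP cE]]]] := R_rows (\row_l f i (u l)).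
have {}cE k : f i (u k) = d * P 0 k by have /rowP/(_ k) := cE; rewrite !mxE.
have P0 : \sum_k P 0 k *: v k = 0.
  apply: g_sep => j; have := h0 i j.
  rewrite linear_sum /= linear_sum /=.
  under eq_bigr do rewrite hE cE -mulrA.
  (* The factor [d] can be cancelled: it divides the nonzero value [f i (u l)]. *)
  rewrite -mulr_sumr => /R_domain[d0|gP].
    by case: fl; rewrite cE d0 mul0r.
  by rewrite -[RHS]gP; apply: eq_bigr => k _; rewrite linearZ.
rewrite -(tens_change_basis u v QP) big_ord_recl P0 tens0r add0r.
apply: IH => i' j.
by rewrite -(h0 i' j) -(tens_change_basis u v QP) big_ord_recl P0 tens0r add0r.
Qed.

End TensorSeparation.

(** * Linearity, products and injectivity of [psi] *)

Section PsiTheory.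
Variables (R : comNzRingType) (X : choiceType) (A : binom_alg R X).
Variable mu : (X -> R) -> (X -> R) -> (X -> R).

Lemma psi2_linear : linear (psi2 (A := A) mu).
Proof.
apply: tensor_lift_linear; split=> [q|q] c x y; apply/funext => s /=.
  by rewrite evalI_linear mulrDl -mulrA.
by rewrite evalI_linear mulrDr mulrCA.
Qed.

Lemma psi2P c (t t' : T2 A) s :
  psi2 mu (c *: t + t') s = c * psi2 mu t s + psi2 mu t' s.
Proof. by rewrite psi2_linear. Qed.

Lemma psi2_0 : psi2 mu (0 : T2 A) = 0.
Proof.
have := psi2_linear (-1) 0 0.
by rewrite scaleN1r addNr scaleN1r addNr.
Qed.

Lemma psi1P c (q r : mX A) a :
  psi1 mu (c *: q + r) a = c * psi1 mu q a + psi1 mu r a.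
Proof. exact: evalI_linear. Qed.

Lemma psi1_0 : psi1 mu (0 : mX A) = 0.
Proof.
apply/funext => a; have := psi1P (-1) 0 0 a.
by rewrite scaleN1r addNr mulN1r addNr.
Qed.

Lemma psi_linear : linear (psi A mu).
Proof.
move=> c u v; rewrite /psi psi2_linear; congr (_, _, _).
by apply/funext => a; rewrite psi1P.
Qed.

Lemma psi_cup (u v : Tle2 A) : psi A mu (Tcup u v) = cup (psi A mu u) (psi A mu v).
Proof.
congr (_, _, _); apply/funext => s /=.
  (* Padding with 0 gives the second summand the shape [c *: q + r] of [psi1P]. *)
  rewrite psi1P -[v.1.1 *: u.1.2]addr0 psi1P psi1_0.
  by rewrite [v.1.1 * _]mulrC addr0.
case: s => a a'; rewrite -[v.1.1 *: u.2]addr0 -addrA -[tens _ _]scale1r.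
rewrite !psi2P psi2_0 psi2_tens mul1r addr0 addrA.
by rewrite [v.1.1 * _]mulrC.
Qed.

Lemma psi1_cup1 (q r : mX A) : psi1 mu (Tcup1_11 q r) = cup1_11 (psi1 mu q) (psi1 mu r).
Proof. by apply/funext => a; rewrite /psi1 /= evalIM. Qed.

(** On a pure tensor both sides at [(a, a')] are [q(a) q'(a') (r(a) + r(a'))]. *)
Lemma psi2_cup1 (t : T2 A) (r : mX A) :
  psi2 mu (Tcup1_21 t r) = cup1_21 (psi2 mu t) (psi1 mu r).
Proof.
have lin : linear (fun t : T2 A => Tcup1_21 t r).
  apply: tensor_lift_linear; split=> [b'|a'] d x y.
    by rewrite (Tcup1_11_bilin A).1 !tens_linl scalerDr addrACA.
  by rewrite (Tcup1_11_bilin A).1 !tens_linr scalerDr addrACA.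
move: t; apply: tensor_ind => [c q q' t IH|].
  rewrite lin Tcup1_21E; apply/funext => -[a a'].
  rewrite psi2P IH /cup1_21 psi2P mulrDl; congr (_ + _).
  rewrite -mulrA; congr (_ * _).
  rewrite -[tens _ q']scale1r psi2P mul1r !psi2_tens /= !evalIM /psi1.
  by rewrite mulrDr mulrA mulrAC.
have -> : Tcup1_21 (0 : T2 A) r = 0.
  by have := lin (-1) 0 0; rewrite scaleN1r addNr scaleN1r addNr.
by rewrite psi2_0; apply/funext => s; rewrite /cup1_21 mul0r.
Qed.

Lemma psi2_circ (s t : T2 A) : psi2 mu (Tcirc s t) = circ (psi2 mu s) (psi2 mu t).
Proof.
have bl : bilin (@Tcirc R X A) by apply: tensor_map2_bilin; exact: Tcup1_11_bilin.
have T0l u : Tcirc (0 : T2 A) u = 0.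
  by have := bl.1 u (-1) 0 0; rewrite scaleN1r addNr scaleN1r addNr.
have T0r u : Tcirc u (0 : T2 A) = 0.
  by have := bl.2 u (-1) 0 0; rewrite scaleN1r addNr scaleN1r addNr.
move: s; apply: tensor_ind => [c q q' s IH|]; last first.
  by rewrite T0l psi2_0; apply/funext => x; rewrite /circ mul0r.
rewrite bl.1; apply/funext => x; rewrite psi2P IH /circ psi2P mulrDl -mulrA; congr (_ + _).
congr (_ * _).
move: t {IH}; apply: tensor_ind => [d r r' t IH|]; last first.
  by rewrite T0r psi2_0 mulr0.
rewrite bl.2 !psi2P IH mulrDr; congr (_ + _).
case: x {IH} => a a'; rewrite Tcirc_tens !psi2_tens /= !evalIM [RHS]mulrCA.
by congr (_ * _); rewrite mulrACA.
Qed.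

Hypothesis R_domain : forall x y : R, x * y = 0 -> x = 0 \/ y = 0.
Hypothesis R_rows : has_primitive_rows R.
Hypothesis ev_sep : forall q : mX A, (forall a, evalI a (val q) = 0) -> q = 0.

Lemma psi_injective : injective (psi A mu).
Proof.
pose Psi : {linear Tle2 A -> Cmu mu} := HB.pack (psi A mu)
  (GRing.isLinear.Build _ _ _ _ (psi A mu) psi_linear).
apply: (@raddf_inj _ _ Psi) => -[[r q] t] /= [r0 q0 t0].
have ev_lin a : linear (fun q : mX A => evalI a (val q) : R^o).
  by move=> c x y; rewrite evalI_linear.
have psi2_lin a a' : linear (fun t : T2 A => psi2 mu t (a, a') : R^o).
  by move=> c x y; rewrite psi2P.
pose F a : {linear mX A -> R^o} := HB.pack (fun q : mX A => evalI a (val q) : R^o)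
  (GRing.isLinear.Build _ _ _ _ _ (ev_lin a)).
pose H a a' : {linear T2 A -> R^o} := HB.pack (fun t : T2 A => psi2 mu t (a, a') : R^o)
  (GRing.isLinear.Build _ _ _ _ _ (psi2_lin a a')).
(* Degree 0 is read at the only vertex, degree 1 at all edges, and degree 2 by separating tensors
   with pairs of evaluations. *)
congr (_, _, _).
- exact: (congr1 (fun f => f tt) r0).
- by apply: ev_sep => a; exact: (congr1 (fun f => f a) q0).
- apply: (@tensor_separated _ _ _ _ _ F F H) => // [a a' u v|a a'].
    exact: psi2_tens.
  exact: (congr1 (fun f => f (a, a')) t0).
Qed.

End PsiTheory.

(** * The coefficient rings Z and F_p *)

Lemma coef_ring_domain k (x y : coef_ring k) : x * y = 0 -> x = 0 \/ y = 0.
Proof.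
by case: k x y => [|p] x y /eqP; rewrite mulf_eq0 => /orP[]/eqP; [left|right|left|right].
Qed.

Lemma coef_ring_rows k : has_primitive_rows (coef_ring k).
Proof. by case: k => [|p]; [exact: int_has_primitive_rows|exact: field_has_primitive_rows]. Qed.

Lemma mX_separated k X (q : mX (IntR k X)) :
  (forall a, evalI a (val q) = 0) -> q = 0.
Proof.
case: k q => [|p] [q qc] /= q0; apply: val_inj; first exact: evZ_inj.
(* By definition of [IntFp_const0], the element is the reduction of an integer-valued polynomial
   [r]. *)
have /asboolP[r _ E] := qc; rewrite /= E in q0 *.
by apply: redFp_eq0 => a; rewrite -evFp_red.
Qed.

Theorem lemma7p1 (k : coef) (X : choiceType)
    (mu : (X -> coef_ring k) -> (X -> coef_ring k) -> (X -> coef_ring k)) :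
  let A := IntR k X in
  [/\ linear (psi A mu),
      injective (psi A mu),
      (forall u v : Tle2 A,
         psi A mu (Tcup u v) = cup (psi A mu u) (psi A mu v)),
      (forall q r : mX A,
         psi1 mu (Tcup1_11 q r) = cup1_11 (psi1 mu q) (psi1 mu r)) /\
      (forall (t : T2 A) (r : mX A),
         psi2 mu (Tcup1_21 t r) = cup1_21 (psi2 mu t) (psi1 mu r))
    & (forall s t : T2 A,
         psi2 mu (Tcirc s t) = circ (psi2 mu s) (psi2 mu t))].
Proof.
split.
- exact: psi_linear.
- apply: psi_injective; [exact: coef_ring_domain|exact: coef_ring_rows|exact: mX_separated].
- exact: psi_cup.
- by split; [exact: psi1_cup1|exact: psi2_cup1].
- exact: psi2_circ.
Qed.
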